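(* Any four-dimensional subalgebra of $\mathfrak{b}$ that contains $\mathfrak{t}$ is equivalent to one of the following inequivalent subalgebras: $$\langle\mathfrak{t},X_{\alpha},X_{\alpha+\beta}\rangle,\qquad \langle\mathfrak{t},X_{\alpha},X_{\alpha+2\beta}\rangle .$$
   Context: Let $J=\begin{pmatrix}0&0&1&0\\0&0&0&1\\-1&0&0&0\\0&-1&0&0\end{pmatrix}$. $\mathfrak{sp}(4,\mathbb{C})$ is the Lie algebra of $4\times4$ complex matrices $X$ with $JX^tJ=X$, and $Sp(4,\mathbb{C})=\{g\in GL(4,\mathbb{C}) : gJg^t=J\}$, acting on $\mathfrak{sp}(4,\mathbb{C})$ by conjugation $X\mapsto gXg^{-1}$. For $a,b\in\mathbb{C}$, $T_{a,b}=\mathrm{diag}(a,b,-a,-b)$, and $\mathfrak{t}=\{T_{a,b}: a,b\in\mathbb{C}\}$. With $E_{ij}$ the matrix units, $X_\alpha=E_{24}$, $X_\beta=E_{12}-E_{43}$, $X_{\alpha+\beta}=E_{14}+E_{23}$, $X_{\alpha+2\beta}=E_{13}$. $\langle\,\cdot\,\rangle$ denotes the complex linear span of the listed elements and subspaces. $\mathfrak{b}=\mathfrak{t}\oplus\langle X_\alpha,X_\beta,X_{\alpha+\beta},X_{\alpha+2\beta}\rangle$ is the Borel subalgebra. Two subalgebras are equivalent if some $g\in Sp(4,\mathbb{C})$ conjugates one onto the other. *)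

(* Defs.v *)
From mathcomp Require Import all_boot all_order all_algebra.
From mathcomp Require Import complex.
From mathcomp Require Import reals.
From mathcomp Require Import ring.

Set Implicit Arguments.
Unset Strict Implicit.
Unset Printing Implicit Defensive.

Import GRing.Theory.
Local Open Scope ring_scope.

Section Sp4.
Variable R : realType.
Local Notation C := R[i].

Definition symp_J : 'M[C]_4 := block_mx (0 : 'M_2) 1%:M (- 1%:M) (0 : 'M_2).

Definition sp4 : {pred 'M[C]_4} := [pred X | symp_J *m X^T *m symp_J == X].

Definition Sp4 : {pred 'M[C]_4} :=
  [pred g | (g \in unitmx) && (g *m symp_J *m g^T == symp_J)].

Definition bracket (X Y : 'M[C]_4) : 'M[C]_4 := X *m Y - Y *m X.

(* Matrix units are indexed from 1; meant for 1 <= i, j <= 4. *)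
Definition E (i j : nat) : 'M[C]_4 := delta_mx (inord i.-1) (inord j.-1).

Definition T (a b : C) : 'M[C]_4 := diag_mx (\row_j [:: a; b; - a; - b]`_j).

Definition X_alpha : 'M[C]_4 := E 2 4.
Definition X_beta : 'M[C]_4 := E 1 2 - E 4 3.
Definition X_alpha_beta : 'M[C]_4 := E 1 4 + E 2 3.
Definition X_alpha_2beta : 'M[C]_4 := E 1 3.

(* As a set this is {T a b | a, b in C}; see torusP. *)
Definition torus : {vspace 'M[C]_4} := <<([:: T 1 0; T 0 1])%R>>%VS.

Definition borel : {vspace 'M[C]_4} :=
  (torus + <<[:: X_alpha; X_beta; X_alpha_beta; X_alpha_2beta]>>)%VS.

Definition lie_subalgebra (V L : {vspace 'M[C]_4}) : Prop :=
  (V <= L)%VS /\ {in V &, forall X Y, bracket X Y \in V}.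

Definition conjugation (g : 'M[C]_4) : 'M[C]_4 -> 'M[C]_4 :=
  mulmxr (invmx g) \o mulmx g.

Definition equivalent (V W : {vspace 'M[C]_4}) : Prop :=
  exists2 g, g \in Sp4 & (linfun (conjugation g) @: V)%VS = W.

Definition subalg_alpha_alpha_beta : {vspace 'M[C]_4} :=
  (torus + <<[:: X_alpha; X_alpha_beta]>>)%VS.

Definition subalg_alpha_alpha_2beta : {vspace 'M[C]_4} :=
  (torus + <<[:: X_alpha; X_alpha_2beta]>>)%VS.

Lemma T_lin (a b : C) : T a b = a *: T 1 0 + b *: T 0 1.
Proof.
apply/matrixP => i j; rewrite !mxE.
case: (i == j); rewrite ?mulr1n ?mulr0n; last by ring.
by case: i => -[|[|[|[|//]]]] ? /=; ring.
Qed.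

Lemma torusP X : reflect (exists a b, X = T a b) (X \in torus).
Proof.
rewrite /torus span_cons span_seq1; apply: (iffP memv_addP).
  move=> [u /vlineP[a ->] [v /vlineP[b ->] ->]].
  by exists a, b; rewrite (T_lin a b).
move=> [a [b ->]]; exists (a *: T 1 0); first by rewrite memvZ ?memv_line.
by exists (b *: T 0 1); rewrite ?(T_lin a b) // memvZ ?memv_line.
Qed.

Lemma conjugationE g X : linfun (conjugation g) X = g *m X *m invmx g.
Proof. by rewrite lfunE. Qed.

Lemma block_sp (K : comNzRingType) n (X : 'M[K]_(n + n))
    (J := block_mx 0 1%:M (- 1%:M) 0) :
  ulsubmx X = - (drsubmx X)^T -> (ursubmx X)^T = ursubmx X ->
  (dlsubmx X)^T = dlsubmx X -> J *m X^T *m J = X.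
Proof.
move=> hA hB hC.
have hD : - (ulsubmx X)^T = drsubmx X by rewrite hA raddfN /= trmxK opprK.
rewrite -[X in X^T]submxK tr_block_mx !mulmx_block.
rewrite !(mul0mx, mulmx0, mul1mx, mulmxN, mulNmx, mulmx1, addr0, add0r) opprK.
by rewrite hB hC -hA hD submxK.
Qed.

Lemma borel_sub_sp4 : {subset borel <= sp4}.
Proof.
pose f (X : 'M[C]_4) := symp_J *m X^T *m symp_J - X.
have fD X Y : f (X + Y) = f X + f Y.
  by rewrite /f linearD mulmxDr mulmxDl opprD addrACA.
have fZ a X : f (a *: X) = a *: f X.
  by rewrite /f linearZ /= -scalemxAr -scalemxAl scalerBr.
have f0 X : X \in sp4 = (f X == 0) by rewrite inE subr_eq0.
pose s := [:: T 1 0; T 0 1; X_alpha; X_beta; X_alpha_beta; X_alpha_2beta].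
have sP X : X \in s -> X \in sp4.
  move=> Xs; apply/eqP; apply: (@block_sp _ 2); apply/matrixP => i j;
    rewrite ![in RHS]mxE ?[LHS]mxE; move: Xs;
    case: i j => [[|[|//]] ?] [[|[|//]] ?];
    rewrite !inE => /or4P[|||/or3P[||]] /eqP->; rewrite !mxE //=;
    rewrite -?val_eqE /= ?inordK //=;
    by rewrite ?mulr0n ?mulr1n ?oppr0 ?subr0
      ?sub0r ?addr0 ?mulr0n ?oppr0 ?opprK ?add0r.
have sb : (borel <= <<s>>)%VS by rewrite /borel /torus -span_cat.
move=> X /(subvP sb) /(@coord_span _ _ _ (in_tuple s)) ->; rewrite f0.
elim/big_rec: _ => [|i Y _ /eqP fY];
  first by rewrite /f trmx0 mulmx0 mul0mx subr0.
rewrite fD fY addr0 fZ.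
have /sP : s`_i \in s by apply: mem_nth.
by rewrite f0 => /eqP ->; rewrite scaler0.
Qed.

End Sp4.

(* Main.v *)
Require Import Defs.
From mathcomp Require Import all_boot all_order all_algebra.
From mathcomp Require Import complex.
From mathcomp Require Import reals.
From mathcomp Require Import ring.

(* Root space decomposition: [T 4 1] acts on the four positive root vectors with
   distinct nonzero eigenvalues, so a subalgebra [V] of [borel] containing the
   torus contains every root vector occurring in one of its elements. By
   dimension [V] contains at least two of them, and closure under the bracket
   yields two that span, together with the torus, one of four subalgebras; these
   are related by two Weyl group elements. The number of lines of rank one
   elements separates the two remaining classes. *)

Import GRing.Theory Num.Theory.
Local Open Scope ring_scope.

Section Subalgebras.
Variable R : realType.
Local Notation C := R[i].
Local Notation Xa := (X_alpha R).
Local Notation Xb := (X_beta R).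
Local Notation Xab := (X_alpha_beta R).
Local Notation Xa2b := (X_alpha_2beta R).

(** * Explicit 4x4 matrices and coordinates on the Borel subalgebra *)

Definition mx4 (s : seq (seq C)) : 'M[C]_4 := \matrix_(i, j) (nth [::] s i)`_j.

Lemma mul_mx4 s t : mx4 s *m mx4 t =
  mx4 (mkseq (fun i => mkseq (fun j =>
    \sum_(k <- iota 0 4) (nth [::] s i)`_k * (nth [::] t k)`_j) 4) 4).
Proof.
apply/matrixP => i j; rewrite !mxE !nth_mkseq // -[iota 0 4]/(index_iota 0 4).
by rewrite big_mkord; apply: eq_bigr => k _; rewrite !mxE.
Qed.

Lemma tr_mx4 s :
  (mx4 s)^T = mx4 (mkseq (fun i => mkseq (fun j => (nth [::] s j)`_i) 4) 4).
Proof. by apply/matrixP => i j; rewrite !mxE !nth_mkseq. Qed.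

Lemma mx4_1 : 1%:M =
  mx4 [:: [:: 1; 0; 0; 0]; [:: 0; 1; 0; 0]; [:: 0; 0; 1; 0]; [:: 0; 0; 0; 1]].
Proof.
by apply/matrixP => -[[|[|[|[|//]]]] ?] [[|[|[|[|//]]]] ?]; rewrite !mxE.
Qed.

(** Coordinates on [borel R]: [a], [b] for the torus, and [x], [y], [z], [w] for the root vectors
    [Xa], [Xb], [Xab], [Xa2b]. *)
Definition borel_mx (a b x y z w : C) : 'M[C]_4 :=
  mx4 [:: [:: a; y; w; z]; [:: 0; b; z; x]; [:: 0; 0; - a; 0];
          [:: 0; 0; - y; - b]].

Lemma symp_JE : symp_J R =
  mx4 [:: [:: 0; 0; 1; 0]; [:: 0; 0; 0; 1]; [:: -1; 0; 0; 0]; [:: 0; -1; 0; 0]].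
Proof.
rewrite /symp_J -[RHS](@submxK _ 2 2 2 2); f_equal;
  by apply/matrixP => -[[|[|//]] ?] [[|[|//]] ?]; rewrite !mxE /= ?oppr0.
Qed.

Ltac mx4_ring :=
  (* Unlocking the big operator lets the sums over [iota 0 4] compute to explicit polynomials in the
     entries. *)
  rewrite ?tr_mx4 ?mul_mx4 /= ?unlock /=;
  apply/matrixP => -[[|[|[|[|//]]]] ?] [[|[|[|[|//]]]] ?];
  rewrite !mxE /=; ring.

Lemma borel_mxE a b x y z w :
  borel_mx a b x y z w = T a b + (x *: Xa + y *: Xb + z *: Xab + w *: Xa2b).
Proof.
apply/matrixP => -[[|[|[|[|//]]]] ?] [[|[|[|[|//]]]] ?];
  by rewrite !mxE /= -?val_eqE /= ?inordK //= ?mulr1n ?mulr0n; ring.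
Qed.

Lemma borel_mxD a b x y z w a' b' x' y' z' w' :
  borel_mx a b x y z w + borel_mx a' b' x' y' z' w' =
  borel_mx (a + a') (b + b') (x + x') (y + y') (z + z') (w + w').
Proof. by mx4_ring. Qed.

Lemma borel_mxZ c a b x y z w :
  c *: borel_mx a b x y z w =
  borel_mx (c * a) (c * b) (c * x) (c * y) (c * z) (c * w).
Proof. by mx4_ring. Qed.

(** The roots can be read off as [2b], [a - b], [a + b], [2a]. The remaining terms encode [[Xb, Xa]
    = Xab] and [[Xb, Xab] = 2 Xa2b]. *)
Lemma bracket_borel_mx a b x y z w a' b' x' y' z' w' :
  bracket (borel_mx a b x y z w) (borel_mx a' b' x' y' z' w') =
  borel_mx 0 0 ((b * x' - b' * x) *+ 2) ((a - b) * y' - (a' - b') * y)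
    ((a + b) * z' - (a' + b') * z + (y * x' - y' * x))
    ((a * w' - a' * w) *+ 2 + (y * z' - y' * z) *+ 2).
Proof. by rewrite /bracket; mx4_ring. Qed.

Lemma T_alpha_alpha_beta a b x z :
  T a b + (x *: Xa + z *: Xab) = borel_mx a b x 0 z 0.
Proof. by rewrite borel_mxE !scale0r !addr0. Qed.

Lemma T_alpha_alpha_2beta a b x w :
  T a b + (x *: Xa + w *: Xa2b) = borel_mx a b x 0 0 w.
Proof. by rewrite borel_mxE !scale0r !addr0. Qed.

Lemma T_beta_alpha_2beta a b y w :
  T a b + (y *: Xb + w *: Xa2b) = borel_mx a b 0 y 0 w.
Proof. by rewrite borel_mxE !scale0r addr0 add0r. Qed.

Lemma T_alpha_beta_alpha_2beta a b z w :
  T a b + (z *: Xab + w *: Xa2b) = borel_mx a b 0 0 z w.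
Proof. by rewrite borel_mxE !scale0r !add0r. Qed.

Lemma X_alphaE : Xa = borel_mx 0 0 1 0 0 0.
Proof. by rewrite borel_mxE T_lin !scale0r scale1r !addr0 add0r. Qed.

Lemma X_betaE : Xb = borel_mx 0 0 0 1 0 0.
Proof. by rewrite borel_mxE T_lin !scale0r scale1r !addr0 !add0r. Qed.

Lemma X_alpha_betaE : Xab = borel_mx 0 0 0 0 1 0.
Proof. by rewrite borel_mxE T_lin !scale0r scale1r !addr0 !add0r. Qed.

Lemma X_alpha_2betaE : Xa2b = borel_mx 0 0 0 0 0 1.
Proof. by rewrite borel_mxE T_lin !scale0r scale1r !addr0 !add0r. Qed.

Lemma borel_mx_inj a b x y z w a' b' x' y' z' w' :
  borel_mx a b x y z w = borel_mx a' b' x' y' z' w' ->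
  [/\ a = a', b = b' & [/\ x = x', y = y', z = z' & w = w']].
Proof.
move=> /matrixP e.
have e' i j (hi : (i < 4)%N) (hj : (j < 4)%N) := e (Ordinal hi) (Ordinal hj).
have := (e' 0 0 isT isT, e' 1 1 isT isT, e' 1 3 isT isT, e' 0 1 isT isT,
  e' 0 3 isT isT, e' 0 2 isT isT)%N.
by rewrite !mxE /= => -[[[[[-> ->] ->] ->] ->] ->].
Qed.

(** * Membership and dimension for spans containing the torus *)

Lemma torus_span2P (A B X : 'M[C]_4) :
  reflect (exists a b x y, X = T a b + (x *: A + y *: B))
    (X \in (torus R + <<[:: A; B]>>)%VS).
Proof.
rewrite span_cons span_seq1; apply: (iffP memv_addP).
  move=> [_ /torusP[a [b ->]] [_ /memv_addP[_ /vlineP[x ->]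
    [_ /vlineP[y ->] ->]] ->]].
  by exists a, b, x, y.
move=> [a [b [x [y ->]]]]; exists (T a b); first by apply/torusP; exists a, b.
by exists (x *: A + y *: B); rewrite // memv_add // memvZ ?memv_line.
Qed.

Lemma borelP (X : 'M[C]_4) :
  reflect (exists a b x y z w, X = borel_mx a b x y z w) (X \in borel R).
Proof.
rewrite /borel !span_cons span_nil addv0; apply: (iffP memv_addP).
  move=> [_ /torusP[a [b ->]] [_ /memv_addP[_ /vlineP[x ->]
    [_ /memv_addP[_ /vlineP[y ->] [_ /memv_addP[_ /vlineP[z ->]
    [_ /vlineP[w ->] ->]] ->]] ->]] ->]].
  by exists a, b, x, y, z, w; rewrite borel_mxE -!(addrA (x *: Xa)) -addrA.
move=> [a [b [x [y [z [w ->]]]]]]; rewrite borel_mxE.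
exists (T a b); first by apply/torusP; exists a, b.
exists (x *: Xa + y *: Xb + z *: Xab + w *: Xa2b); rewrite // -!addrA.
by do !apply: memv_add; apply: memvZ; apply: memv_line.
Qed.

Lemma dim_torus_span2 (A B : 'M[C]_4) :
  (forall a b x y, T a b + (x *: A + y *: B) = 0 ->
     [/\ a = 0, b = 0, x = 0 & y = 0]) ->
  \dim (torus R + <<[:: A; B]>>)%VS = 4%N.
Proof.
move=> indep; rewrite /torus -span_cat.
set s := (_ ++ _); suff /eqP -> : free s by [].
apply/(@freeP _ _ 4 (in_tuple s)) => k; rewrite !big_ord_recl big_ord0 /= => k0.
have [k1 k2 k3 k4] : [/\ k ord0 = 0, k (lift ord0 ord0) = 0,
    k (lift ord0 (lift ord0 ord0)) = 0 &
    k (lift ord0 (lift ord0 (lift ord0 ord0))) = 0].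
  by apply: indep; rewrite T_lin -k0 addr0 !addrA.
by case=> -[|[|[|[|//]]]] ?; [rewrite -[RHS]k1|rewrite -[RHS]k2
  |rewrite -[RHS]k3|rewrite -[RHS]k4]; congr k; apply: val_inj.
Qed.

Lemma dim_root_pairs :
  [/\ \dim (torus R + <<[:: Xa; Xab]>>)%VS = 4%N,
      \dim (torus R + <<[:: Xa; Xa2b]>>)%VS = 4%N,
      \dim (torus R + <<[:: Xb; Xa2b]>>)%VS = 4%N
    & \dim (torus R + <<[:: Xab; Xa2b]>>)%VS = 4%N].
Proof.
have E0 : 0 = borel_mx 0 0 0 0 0 0 by rewrite borel_mxE T_lin !scale0r !addr0.
split; apply: dim_torus_span2 => a b x y; rewrite {1}E0.
- by rewrite T_alpha_alpha_beta => /borel_mx_inj[-> -> [-> _ -> _]].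
- by rewrite T_alpha_alpha_2beta => /borel_mx_inj[-> -> [-> _ _ ->]].
- by rewrite T_beta_alpha_2beta => /borel_mx_inj[-> -> [_ -> _ ->]].
- by rewrite T_alpha_beta_alpha_2beta => /borel_mx_inj[-> -> [_ _ -> ->]].
Qed.

(** * Root vectors contained in a subalgebra *)

Section BorelSubalgebra.
Variable V : {vspace 'M[C]_4}.
Hypotheses (subV : lie_subalgebra V (borel R)) (tV : (torus R <= V)%VS).

(* [T 4 1] takes the distinct nonzero values 2, 3, 5, 8 on the four positive
   roots. *)
Lemma ad_shift_mem l a b x y z w : borel_mx a b x y z w \in V ->
  borel_mx (- l * a) (- l * b) ((2 - l) * x) ((3 - l) * y) ((5 - l) * z)
    ((8 - l) * w) \in V.
Proof.
move=> XV; have [_ brV] := subV.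
have HV : borel_mx 4 1 0 0 0 0 \in V.
  apply: (subvP tV); apply/torusP; exists 4, 1.
  by rewrite borel_mxE !scale0r !addr0.
have := memvD (brV _ _ HV XV) (memvZ (- l) XV).
rewrite bracket_borel_mx borel_mxZ borel_mxD; congr (_ \in V).
by congr borel_mx; ring.
Qed.

Lemma memv_scale_inv (k : C) (X : 'M[C]_4) : k != 0 -> k *: X \in V -> X \in V.
Proof. by move=> k0 /(memvZ k^-1); rewrite scalerA mulVf // scale1r. Qed.

(** With [H = T 4 1], the operator [ad H - l] preserves [V]. Composing it for [l = 0], which kills
    the torus part, and for three of the four root values leaves a nonzero multiple of the remaining
    root component. *)
Lemma root_component_mem a b x y z w : borel_mx a b x y z w \in V ->
  [/\ x != 0 -> Xa \in V, y != 0 -> Xb \in V, z != 0 -> Xab \in V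
    & w != 0 -> Xa2b \in V].
Proof.
move=> /(ad_shift_mem 0) XV.
split=> nz.
(* The factor is the product of [2 - l] over [l = 0, 3, 5, 8]; the factors 30, -90 and 720 below
   arise likewise from 3, 5 and 8. *)
- apply: (@memv_scale_inv (- 36%:R * x)).
    by rewrite mulf_neq0 // oppr_eq0 pnatr_eq0.
  move: XV => /(ad_shift_mem 3)/(ad_shift_mem 5)/(ad_shift_mem 8).
  by rewrite X_alphaE borel_mxZ; congr (_ \in V); congr borel_mx; ring.
- apply: (@memv_scale_inv (30%:R * y)).
    by rewrite mulf_neq0 // pnatr_eq0.
  move: XV => /(ad_shift_mem 2)/(ad_shift_mem 5)/(ad_shift_mem 8).
  by rewrite X_betaE borel_mxZ; congr (_ \in V); congr borel_mx; ring.
- apply: (@memv_scale_inv (- 90%:R * z)).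
    by rewrite mulf_neq0 // oppr_eq0 pnatr_eq0.
  move: XV => /(ad_shift_mem 2)/(ad_shift_mem 3)/(ad_shift_mem 8).
  by rewrite X_alpha_betaE borel_mxZ; congr (_ \in V); congr borel_mx; ring.
- apply: (@memv_scale_inv (720%:R * w)).
    by rewrite mulf_neq0 // pnatr_eq0.
  move: XV => /(ad_shift_mem 2)/(ad_shift_mem 3)/(ad_shift_mem 5).
  by rewrite X_alpha_2betaE borel_mxZ; congr (_ \in V); congr borel_mx; ring.
Qed.

End BorelSubalgebra.

Lemma dim_torus_span1 (X : 'M[C]_4) :
  (\dim (torus R + <<[:: X]>>)%VS <= 3)%N.
Proof. by rewrite /torus -span_cat; apply: dim_span. Qed.

(** Dimension four forces at least two root vectors into [V]. Of the six possible pairs, [Xa], [Xb]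
    brings in [Xab], and [Xb], [Xab] brings in [Xa2b], so one of the other four pairs always
    occurs. *)
Lemma root_pair_mem (V : {vspace 'M[C]_4}) :
    lie_subalgebra V (borel R) -> \dim V = 4%N -> (torus R <= V)%VS ->
  [|| (Xa \in V) && (Xab \in V), (Xa \in V) && (Xa2b \in V),
      (Xb \in V) && (Xa2b \in V) | (Xab \in V) && (Xa2b \in V)].
Proof.
move=> subV dimV tV; have [/subvP Vb brV] := subV.
have few (X : 'M[C]_4) : ~ {subset V <= (torus R + <<[:: X]>>)%VS}.
  by move/subvP/dimvS/leq_trans/(_ (dim_torus_span1 X)); rewrite dimV.
have ab : Xa \in V -> Xb \in V -> Xab \in V.
  move=> aV bV; have := brV _ _ bV aV; congr (_ \in V).
  rewrite X_alphaE X_betaE X_alpha_betaE bracket_borel_mx.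
  by congr borel_mx; ring.
have bab : Xb \in V -> Xab \in V -> Xa2b \in V.
  move=> bV abV; apply: (@memv_scale_inv _ 2); first by rewrite pnatr_eq0.
  have := brV _ _ bV abV; congr (_ \in V).
  rewrite X_betaE X_alpha_betaE X_alpha_2betaE bracket_borel_mx borel_mxZ.
  by congr borel_mx; ring.
have one (X : 'M[C]_4) : (forall a b x y z w, borel_mx a b x y z w \in V ->
    exists c, borel_mx a b x y z w = T a b + c *: X) -> False.
  move=> h; apply: (few X) => Y YV.
  have /borelP[a [b [x [y [z [w eY]]]]]] := Vb _ YV.
  have [c eYc] : exists c, Y = T a b + c *: X by rewrite eY;
    apply: h; rewrite -eY.
  rewrite eYc memv_add //; first by apply/torusP; exists a, b.
  by rewrite span_seq1 memvZ ?memv_line.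
have notin (A : 'M[C]_4) (c : C) : A \notin V -> (c != 0 -> A \in V) -> c = 0.
  by move=> /negPf -> h; apply/eqP/negPn/negP => /h.
(* Seven of the sixteen cases survive evaluation: the two bracket-generating pairs alone, the four
   single root vectors, and none at all. *)
have [aV|aV] := boolP (Xa \in V); have [bV|bV] := boolP (Xb \in V);
have [abV|abV] := boolP (Xab \in V); have [a2bV|a2bV] := boolP (Xa2b \in V);
rewrite //=; exfalso.
- by rewrite ab in abV.
- apply: (one Xa) => a b x y z w /(root_component_mem V subV tV)[xV yV zV wV].
  exists x; rewrite (notin _ _ bV yV) (notin _ _ abV zV) (notin _ _ a2bV wV).
  by rewrite borel_mxE !scale0r !addr0.
- by rewrite bab in a2bV.
- apply: (one Xb) => a b x y z w /(root_component_mem V subV tV)[xV yV zV wV].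
  exists y; rewrite (notin _ _ aV xV) (notin _ _ abV zV) (notin _ _ a2bV wV).
  by rewrite borel_mxE !scale0r !addr0 add0r.
- apply: (one Xab) => a b x y z w /(root_component_mem V subV tV)[xV yV zV wV].
  exists z; rewrite (notin _ _ aV xV) (notin _ _ bV yV) (notin _ _ a2bV wV).
  by rewrite borel_mxE !scale0r addr0 !add0r.
- apply: (one Xa2b) => a b x y z w /(root_component_mem V subV tV)[xV yV zV wV].
  exists w; rewrite (notin _ _ aV xV) (notin _ _ bV yV) (notin _ _ abV zV).
  by rewrite borel_mxE !scale0r !add0r.
(* Here [V] contains no root vector; enclosing it in the torus plus the line of [Xa] already
   contradicts the dimension. *)
- apply: (one Xa) => a b x y z w /(root_component_mem V subV tV)[xV yV zV wV].
  exists x; rewrite (notin _ _ bV yV) (notin _ _ abV zV) (notin _ _ a2bV wV).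
  by rewrite borel_mxE !scale0r !addr0.
Qed.

(** * Equivalences given by Weyl group elements *)

Lemma torus_span2_eq (V : {vspace 'M[C]_4}) (A B : 'M[C]_4) :
    \dim V = 4%N -> (torus R <= V)%VS -> A \in V -> B \in V ->
  \dim (torus R + <<[:: A; B]>>)%VS = 4%N -> V = (torus R + <<[:: A; B]>>)%VS.
Proof.
move=> dimV tV AV BV dimW; apply/esym/eqP; rewrite eqEdim dimV dimW leqnn andbT.
by rewrite subv_add tV span_cons span_seq1 subv_add -!memvE AV.
Qed.

(** The image contains the target and has dimension at most four, so they agree. Writing the
    conjugation as [g X = X' g] keeps inverses out of the matrix computations. *)
Lemma equivalent_torus_span2 (g A B A' B' : 'M[C]_4) :
    g *m symp_J R *m g^T = symp_J R -> g *m g^T = 1%:M ->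
    \dim (torus R + <<[:: A; B]>>)%VS = 4%N ->
    \dim (torus R + <<[:: A'; B']>>)%VS = 4%N ->
    (forall a' b' x' y', exists a b x y,
       g *m (T a b + (x *: A + y *: B)) =
       (T a' b' + (x' *: A' + y' *: B')) *m g) ->
  equivalent (torus R + <<[:: A; B]>>)%VS (torus R + <<[:: A'; B']>>)%VS.
Proof.
move=> gJ gT dimV dimW onto.
have [ug _] := mulmx1_unit gT.
exists g; first by rewrite inE ug gJ eqxx.
apply/esym/eqP; rewrite eqEdim andbC dimW -[X in (_ <= X)%N]dimV.
rewrite -[X in (_ <= X)%N](limg_ker_dim (linfun (conjugation g))) leq_addl /=.
apply/subvP => X /torus_span2P[a' [b' [x' [y' ->]]]].
have [a [b [x [y e]]]] := onto a' b' x' y'.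
rewrite -(mulmxK ug (_ + _)) -e -conjugationE memv_img //.
by apply/torus_span2P; exists a, b, x, y.
Qed.

Lemma equivalent_refl (V : {vspace 'M[C]_4}) : equivalent V V.
Proof.
exists 1%:M; first by rewrite inE unitmx1 mul1mx trmx1 mulmx1 eqxx.
rewrite -[RHS]lim1g; apply: eq_in_limg => X _.
by rewrite conjugationE id_lfunE invmx1 mul1mx mulmx1.
Qed.

(* The element of the Weyl group exchanging the two coordinates of the torus. *)
Lemma equivalent_ab_a2b :
  equivalent (torus R + <<[:: Xab; Xa2b]>>)%VS (subalg_alpha_alpha_beta R).
Proof.
have [dim1 _ _ dim2] := dim_root_pairs.
pose g := mx4 [:: [:: 0; 1; 0; 0]; [:: 1; 0; 0; 0]; [:: 0; 0; 0; 1];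
                  [:: 0; 0; 1; 0]].
apply: (@equivalent_torus_span2 g) => //.
- by rewrite symp_JE; mx4_ring.
- by rewrite mx4_1; mx4_ring.
move=> a b x y; exists b, a, y, x.
by rewrite T_alpha_beta_alpha_2beta T_alpha_alpha_beta; mx4_ring.
Qed.

(* The element of the Weyl group acting on the torus by (a, b) |-> (- b, a). *)
Lemma equivalent_b_a2b :
  equivalent (torus R + <<[:: Xb; Xa2b]>>)%VS (subalg_alpha_alpha_beta R).
Proof.
have [dim1 _ dim2 _] := dim_root_pairs.
pose g := mx4 [:: [:: 0; 0; 0; 1]; [:: 1; 0; 0; 0]; [:: 0; -1; 0; 0];
                  [:: 0; 0; 1; 0]].
apply: (@equivalent_torus_span2 g) => //.
- by rewrite symp_JE; mx4_ring.
- by rewrite mx4_1; mx4_ring.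
(* Conjugation by [g] sends [Xa2b] to [Xa] and [Xb] to [- Xab], whence the sign of [y]. *)
move=> a b x y; exists b, (- a), (- y), x.
by rewrite T_beta_alpha_2beta T_alpha_alpha_beta; mx4_ring.
Qed.

(** * The two representatives are subalgebras *)

Lemma subalg_alpha_alpha_betaP (X : 'M[C]_4) :
  reflect (exists a b x z, X = borel_mx a b x 0 z 0)
    (X \in subalg_alpha_alpha_beta R).
Proof.
apply: (iffP (torus_span2P _ _ _)) => -[a [b [x [z ->]]]]; exists a, b, x, z;
  by rewrite T_alpha_alpha_beta.
Qed.

Lemma subalg_alpha_alpha_2betaP (X : 'M[C]_4) :
  reflect (exists a b x w, X = borel_mx a b x 0 0 w)
    (X \in subalg_alpha_alpha_2beta R).
Proof.
apply: (iffP (torus_span2P _ _ _)) => -[a [b [x [w ->]]]]; exists a, b, x, w;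
  by rewrite T_alpha_alpha_2beta.
Qed.

(** Every bracket of two positive root vectors that is nonzero involves [Xb], whose coefficient
    vanishes here. *)
Lemma lie_subalgebra_alpha_alpha_beta :
  lie_subalgebra (subalg_alpha_alpha_beta R) (borel R).
Proof.
split.
  apply/subvP => X /subalg_alpha_alpha_betaP[a [b [x [z ->]]]].
  by apply/borelP; exists a, b, x, 0, z, 0.
move=> X Y /subalg_alpha_alpha_betaP[a [b [x [z ->]]]].
move=> /subalg_alpha_alpha_betaP[a' [b' [x' [z' ->]]]].
apply/subalg_alpha_alpha_betaP; rewrite bracket_borel_mx.
exists 0, 0, ((b * x' - b' * x) *+ 2), ((a + b) * z' - (a' + b') * z).
by congr borel_mx; ring.
Qed.

Lemma lie_subalgebra_alpha_alpha_2beta :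
  lie_subalgebra (subalg_alpha_alpha_2beta R) (borel R).
Proof.
split.
  apply/subvP => X /subalg_alpha_alpha_2betaP[a [b [x [w ->]]]].
  by apply/borelP; exists a, b, x, 0, 0, w.
move=> X Y /subalg_alpha_alpha_2betaP[a [b [x [w ->]]]].
move=> /subalg_alpha_alpha_2betaP[a' [b' [x' [w' ->]]]].
apply/subalg_alpha_alpha_2betaP; rewrite bracket_borel_mx.
exists 0, 0, ((b * x' - b' * x) *+ 2), ((a * w' - a' * w) *+ 2).
by congr borel_mx; ring.
Qed.

(** * Inequivalence through rank one elements *)

(* 2x2 minors characterize rank at most one. *)
Lemma minors_delta_mx (g h : 'M[C]_4) i j (M := g *m delta_mx i j *m h)
    k l m n :
  M k l * M m n = M k n * M m l.
Proof.
have ME p q : M p q = g p i * h j q.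
  (* Factoring the matrix unit through dimension one makes [M] the product of column [i] of [g] and
     row [j] of [h]. *)
  rewrite /M -(mul_delta_mx (0 : 'I_1)) !mulmxA -mulmxA -rowE -colE.
  by rewrite mxE big_ord1 !mxE.
by rewrite !ME; ring.
Qed.

(** Three vanishing minors reduce, up to sign, to the squares of [a], [b] and [z], so only the [Xa]
    coordinate survives. *)
Lemma minors_alpha_alpha_beta (M : 'M[C]_4) :
    M \in subalg_alpha_alpha_beta R ->
    (forall k l m n, M k l * M m n = M k n * M m l) ->
  exists x, M = x *: Xa.
Proof.
move=> /subalg_alpha_alpha_betaP[a [b [x [z ->]]]] minors.
have minors' k l m n (hk : (k < 4)%N) (hl : (l < 4)%N) (hm : (m < 4)%N)
  (hn : (n < 4)%N) :=
  minors (Ordinal hk) (Ordinal hl) (Ordinal hm) (Ordinal hn).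
have sq0 (c : C) : c * c = 0 -> c = 0.
  by move/eqP; rewrite mulf_eq0 orbb => /eqP.
have a0 : a = 0.
  apply: sq0; have := (minors' 0 0 2 2 isT isT isT isT)%N; rewrite !mxE /=.
  by rewrite mulr0 mulrN => /eqP; rewrite oppr_eq0 => /eqP.
have b0 : b = 0.
  apply: sq0; have := (minors' 1 1 3 3 isT isT isT isT)%N; rewrite !mxE /=.
  by rewrite mulr0 mulrN => /eqP; rewrite oppr_eq0 => /eqP.
have z0 : z = 0.
  apply: sq0; have := (minors' 0 3 1 2 isT isT isT isT)%N; rewrite !mxE /=.
  by rewrite mul0r.
exists x; rewrite a0 b0 z0 borel_mxE !scale0r !addr0.
by rewrite T_lin !scale0r !add0r.
Qed.

(* In the second algebra the rank one elements [X_alpha], [X_alpha_2beta] are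
   linearly independent; in the first all of them are multiples of [X_alpha]. *)
Lemma not_equivalent_alpha_alpha_beta :
  ~ equivalent (subalg_alpha_alpha_beta R) (subalg_alpha_alpha_2beta R).
Proof.
move=> [g /andP[ug _] eW].
(* Conjugating back preserves rank one, so every matrix unit in the second algebra lies on the
   single line through the conjugate of [Xa]. *)
have pull i j : delta_mx i j \in subalg_alpha_alpha_2beta R ->
    exists x, delta_mx i j = x *: (g *m Xa *m invmx g).
  rewrite -eW => /memv_imgP[Y YV]; rewrite conjugationE => eY.
  have YE : Y = invmx g *m delta_mx i j *m g.
    by rewrite eY !mulmxA mulVmx // mul1mx mulmxKV.
  have [|x Yx] := minors_alpha_alpha_beta _ YV.
    by move=> k l m n; rewrite YE; apply: minors_delta_mx.
  by exists x; rewrite eY Yx -scalemxAr -scalemxAl.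
have [|x1 e1] := pull (inord 1) (inord 3).
  apply/subalg_alpha_alpha_2betaP; exists 0, 0, 1, 0; exact: X_alphaE.
have [|x2 e2] := pull (inord 0) (inord 2).
  apply/subalg_alpha_alpha_2betaP; exists 0, 0, 0, 1; exact: X_alpha_2betaE.
(* Two matrix units on one line satisfy a cross-multiplied relation; its entry at (0, 2) gives
   [x1 = 0], which makes the first unit zero. *)
have /matrixP e : x2 *: (delta_mx (inord 1) (inord 3) : 'M[C]_4) =
   x1 *: delta_mx (inord 0) (inord 2).
  by rewrite e1 e2 !scalerA mulrC.
have x10 : x1 = 0.
  have := e (inord 0) (inord 2); rewrite !mxE -!val_eqE /= !inordK //=.
  by rewrite mulr0 mulr1.
move/matrixP/(_ (inord 1) (inord 3)): e1; rewrite x10 scale0r !mxE !eqxx.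
by move/eqP; rewrite oner_eq0.
Qed.

End Subalgebras.

Theorem theorem8p1 (R : realType) :
  [/\ forall V : {vspace 'M[R[i]]_4},
        lie_subalgebra V (borel R) -> \dim V = 4%N -> (torus R <= V)%VS ->
        equivalent V (subalg_alpha_alpha_beta R) \/
        equivalent V (subalg_alpha_alpha_2beta R),
      lie_subalgebra (subalg_alpha_alpha_beta R) (borel R),
      lie_subalgebra (subalg_alpha_alpha_2beta R) (borel R)
    & ~ equivalent (subalg_alpha_alpha_beta R) (subalg_alpha_alpha_2beta R)].
Proof.
split.
- move=> V subV dimV tV; have [d1 d2 d3 d4] := dim_root_pairs R.
  have /or4P[] := root_pair_mem R V subV dimV tV => /andP[AV BV].
  + left; rewrite (torus_span2_eq R V _ _ dimV tV AV BV d1).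
    exact: equivalent_refl.
  + right; rewrite (torus_span2_eq R V _ _ dimV tV AV BV d2).
    exact: equivalent_refl.
  + left; rewrite (torus_span2_eq R V _ _ dimV tV AV BV d3).
    exact: equivalent_b_a2b.
  + left; rewrite (torus_span2_eq R V _ _ dimV tV AV BV d4).
    exact: equivalent_ab_a2b.
- exact: lie_subalgebra_alpha_alpha_beta.
- exact: lie_subalgebra_alpha_alpha_2beta.
- exact: not_equivalent_alpha_alpha_beta.
Qed.
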